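(* Let $\mu\in\mathbb{R}$, $\sigma>0$, $\sigma_x>0$, $\delta\in(0,1)$, $p\in[0,1]$, $\eta>0$, and assume that $\eta<1$ and $(1-\delta)\sigma_x<\sqrt{2\pi}\,\sigma^3$. Put $\tau=\sigma^{-2}$ and $\tau_x=\sigma_x^{-2}$, and let $R_0$ (collateral risk), $R_1$ (large sale risk), $\bar\theta_a$ and $x_a^\star$ be as defined in the context. If the quality of fundamentals is sufficiently high (low), then collateral risk and large sale risk increase (decrease) as private signals are more precise. Specifically, for $a\in\{0,1\}$: $$\mu>\bar\theta_a(x_a^\star)+\frac{F^{-1}\bigl(1/(1+\eta)\bigr)}{\sqrt{\tau+\tau_x}}\implies\frac{dR_a}{d\tau_x}>0,$$ $$\mu<\bar\theta_a(x_a^\star)\implies\frac{dR_a}{d\tau_x}<0,$$ where $F$ is the standard normal cumulative distribution function.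
   Context: Notation: $F_{m,s}$ is the cumulative distribution function of the normal distribution with mean $m$ and standard deviation $s$; $F=F_{0,1}$. Setting (global game of stablecoin investors): fundamentals $\theta\sim N(\mu,\sigma^2)$; a large seller of mass $\delta$ sells everything with probability $p$ (state $a=1$) and otherwise does not sell (state $a=0$); investors of total mass $1-\delta$ receive private signals $x_i=\theta+\sigma\varepsilon_i$, $\varepsilon_i\sim N(0,\sigma_x^2)$, observe $a$, and each sells (payoff $1$) or holds (payoff $1+\eta$ if the total mass sold is less than $\theta$, and $0$ otherwise). The model specifies the posterior given signal $x$ as $N(\mu_p(x),\sigma_p^2)$ with $\mu_p(x)=\frac{\sigma^2x+\sigma_x^2\mu}{\sigma^2+\sigma_x^2}$ and $\sigma_p^2=\frac{\sigma^2\sigma_x^2}{\sigma^2+\sigma_x^2}$, and the proportion of investors who sell at fundamentals $\theta$, when investors sell exactly at signals below $\bar x$, as $1-F_{\bar x,\sigma_x}(\theta)$. For $a\in\{0,1\}$ and $\bar x\in\mathbb{R}$, $\bar\theta_a(\bar x)$ is the unique real $\theta$ solving $\theta=a\delta+(1-\delta)\bigl(1-F_{\bar x,\sigma_x}(\theta)\bigr)$. The equilibrium switching threshold $x_a^\star$ is the real $\bar x$ (unique under the stated assumption) solving $$F_{\mu_p(\bar x),\sigma_p}(\bar\theta_a(\bar x))-\eta\bigl(1-F_{\mu_p(\bar x),\sigma_p}(\bar\theta_a(\bar x))\bigr)=0 .$$ Risk components: $R_0=(1-p)\,F_{\mu,\sigma}(\bar\theta_0(x_0^\star))$ (collateral risk)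 and $R_1=p\,F_{\mu,\sigma}(\bar\theta_1(x_1^\star))$ (large sale risk). The parameter $\tau_x$ is the precision of private signals and $\mu$ measures the quality of fundamentals. The derivatives are total derivatives in $\tau_x$, with the other parameters ($\mu,\tau,\delta,\eta,p$) fixed and the equilibrium varying with $\tau_x$.
   Formalization: Added: state a has positive probability (p<1 for a=0, p>0 for a=1), else R_a is identically 0; and, if σ>1, x_a* is unique for all precisions near τ_x and (1-δ)σ_x≠√(2π)σ², since the printed bound with σ³ does not then ensure uniqueness or differentiability. *)

(* Defs.v *)
From mathcomp Require Export all_boot all_order all_algebra.
From mathcomp Require Export all_classical all_reals all_analysis.
Export Order.TTheory GRing.Theory Num.Theory.
Export numFieldNormedType.Exports.

Set Implicit Arguments.
Unset Strict Implicit.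
Unset Printing Implicit Defensive.

Local Open Scope classical_set_scope.
Local Open Scope ring_scope.

(* F_{m,s}; the second parameter of [normal_prob] is the standard deviation. *)
Definition normal_cdf {R : realType} (m s x : R) : R :=
  fine (normal_prob m s `]-oo, x]).

(* The inverse of the bijection F_{0,1} : R -> ]0, 1[; a default value
   outside ]0, 1[. *)
Definition std_normal_inv {R : realType} (q : R) : R :=
  get [set z : R | normal_cdf 0 1 z = q].

(* sigma_x as a function of tau_x = sigma_x^-2, for tau_x > 0. *)
Definition sd_of_precision {R : realType} (t : R) : R := (Num.sqrt t)^-1.

Definition post_mean {R : realType} (mu sigma sigma_x x : R) : R :=
  (sigma ^+ 2 * x + sigma_x ^+ 2 * mu) / (sigma ^+ 2 + sigma_x ^+ 2).

Definition post_sd {R : realType} (sigma sigma_x : R) : R :=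
  Num.sqrt (sigma ^+ 2 * sigma_x ^+ 2 / (sigma ^+ 2 + sigma_x ^+ 2)).

(* In state a, at fundamentals theta, when investors sell exactly at signals
   below xbar.  The state a in {0, 1} is a boolean, coerced to nat. *)
Definition mass_sold {R : realType} (a : bool) (delta sigma_x xbar theta : R)
    : R :=
  a%:R * delta + (1 - delta) * (1 - normal_cdf xbar sigma_x theta).

(* theta is unique since [mass_sold] is decreasing in theta. *)
Definition theta_bar {R : realType} (a : bool) (delta sigma_x xbar : R) : R :=
  get [set theta : R | theta = mass_sold a delta sigma_x xbar theta].

Definition indifferent {R : realType} (a : bool)
    (mu sigma delta eta sigma_x xbar : R) : Prop :=
  let G := normal_cdf (post_mean mu sigma sigma_x xbar)
             (post_sd sigma sigma_x) (theta_bar a delta sigma_x xbar) in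
  G - eta * (1 - G) = 0.

(* Meaningful only when [indifferent] has exactly one solution. *)
Definition x_star {R : realType} (a : bool) (mu sigma delta eta sigma_x : R)
    : R :=
  get [set xbar : R | indifferent a mu sigma delta eta sigma_x xbar].

Definition theta_star {R : realType} (a : bool)
    (mu sigma delta eta sigma_x : R) : R :=
  theta_bar a delta sigma_x (x_star a mu sigma delta eta sigma_x).

Definition state_prob {R : realType} (p : R) (a : bool) : R :=
  if a then p else 1 - p.

(* R_0 is collateral risk and R_1 is large sale risk. *)
Definition risk {R : realType} (a : bool) (mu sigma delta eta p sigma_x : R)
    : R :=
  state_prob p a * normal_cdf mu sigma (theta_star a mu sigma delta eta sigma_x).

(* The map whose derivative at tau_x is the total derivative dR_a/dtau_x:
   mu, sigma (equivalently tau), delta, eta and p are fixed. *)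
Definition risk_of_precision {R : realType} (a : bool)
    (mu sigma delta eta p : R) : R -> R :=
  fun t => risk a mu sigma delta eta p (sd_of_precision t).

(* At precisions near t the equilibrium threshold is well defined, and sigma_x
   is not at the critical value sigma_x = sqrt (2 pi) sigma^2 / (1 - delta).
   When (1 - delta) sigma_x < sqrt (2 pi) sigma^2 both hold automatically; at
   the critical value the threshold can be unique near t and yet have an
   infinite derivative in the precision. *)
Definition regular_equilibrium {R : realType} (a : bool)
    (mu sigma delta eta t : R) : Prop :=
  (1 - delta) * sd_of_precision t <> Num.sqrt (2 * pi) * sigma ^+ 2 /\
  \forall u \near t, exists! xbar : R,
    indifferent a mu sigma delta eta (sd_of_precision u) xbar.

(* Main.v *)
(* Write k = F^-1(1/(1+eta)), which is positive because eta < 1, and let u be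
   the precision of private signals.  Indifference says that
     xbar = ((tau + u) theta + k sqrt(tau + u) - tau mu) / u,
   where theta is the critical fundamental of xbar; substituting this, theta*
   is the fixed point of
     theta = a delta + (1 - delta) F(w),
     w = (tau (theta - mu) + k sqrt(tau + u)) / sqrt u.
   Implicit differentiation gives dtheta*/du = (1 - delta) F'(w) w_u / D with
   w_u = tau (mu - theta - k / sqrt(tau + u)) / (2 u^(3/2)) and
   D = 1 - (1 - delta) F'(w) tau / sqrt u.  Uniqueness of the equilibrium gives
   D > 0 off the critical noise level: if D <= 0 at a unique fixed point, then
   theta - (a delta + (1 - delta) F(w)) is decreasing on the side of theta* on
   which w moves towards 0, and so has the wrong sign there. *)

From HB Require Import structures.
From mathcomp Require Import ring lra.
Require Import Defs.

Set Implicit Arguments.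
Unset Strict Implicit.
Unset Printing Implicit Defensive.

Local Open Scope classical_set_scope.
Local Open Scope ring_scope.

(** * The normal cumulative distribution function *)

Section NormalCdf.
Context {R : realType}.
Implicit Types m s x y : R.

(** Viewed as a random variable, the identity has law [normal_prob m s], so the general limits of
    distribution functions at infinity apply to [normal_cdf]. *)
Let idTR : measurableTypeR R -> R := idfun.

#[local] HB.instance Definition _ :=
  @isMeasurableFun.Build _ _ _ _ idTR (@measurable_id _ _ setT).

Let identity_RV m s : {RV (normal_prob m s : probability _ R) >-> R} := idTR.

Lemma cvg_normal_cdfNy m s : normal_cdf m s x @[x --> -oo] --> (0 : R).
Proof. exact: (fine_cvg (cvg_cdfNy0 (identity_RV m s))). Qed.

Lemma cvg_normal_cdfy m s : normal_cdf m s x @[x --> +oo] --> (1 : R).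
Proof. exact: (fine_cvg (cvg_cdfy1 (identity_RV m s))). Qed.

Lemma is_derive_normal_cdf m s x : s != 0 ->
  is_derive x 1 (normal_cdf m s) (normal_pdf m s x).
Proof.
move=> s0.
(* The fundamental theorem of calculus with lower limit -oo; [x + 1] is an arbitrary point to the
   right of [x]. *)
have [||||d e] := @continuous_FTC1 R (normal_pdf m s) -oo%O x (x + 1).
- by rewrite ltrDl.
- by apply: integrableS (integrable_normal_pdf m s).
- by rewrite ltNyr.
- exact: continuous_normal_pdf.
apply: DeriveDef; first exact: d.
by rewrite -derive1E.
Qed.

Lemma normal_pdf_gt0 m s x : s != 0 -> 0 < normal_pdf m s x.
Proof. by move=> s0; rewrite normal_pdfE// mulr_gt0 ?normal_peak_gt0 ?expR_gt0. Qed.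

Lemma MVT_is_derive (f df : R -> R) x y :
  (forall z : R, is_derive z 1 f (df z)) -> x < y ->
  exists2 c, c \in `]x, y[ & f y - f x = df c * (y - x).
Proof.
move=> fdf xy; apply: MVT => //; apply: continuous_subspaceT => z.
exact/differentiable_continuous/derivable1_diffP.
Qed.

Lemma normal_cdf_lt m s : s != 0 -> {homo normal_cdf m s : x y / x < y}.
Proof.
move=> s0 x y xy; rewrite -subr_gt0.
have [c _ ->] := MVT_is_derive (fun z => is_derive_normal_cdf m z s0) xy.
by rewrite mulr_gt0 ?subr_gt0// normal_pdf_gt0.
Qed.

Lemma normal_cdf_gt0 m s x : s != 0 -> 0 < normal_cdf m s x.
Proof.
move=> s0; apply: le_lt_trans (_ : normal_cdf m s (x - 1) < _).
  by apply: fine_ge0; exact: measure_ge0.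
by apply: normal_cdf_lt => //; rewrite ltrBlDr ltrDl.
Qed.

Lemma normal_cdf_lt1 m s x : s != 0 -> normal_cdf m s x < 1.
Proof.
move=> s0; apply: lt_le_trans (_ : normal_cdf m s (x + 1) <= _).
  by apply: normal_cdf_lt => //; rewrite ltrDl.
rewrite -lee_fin fineK ?fin_num_measure//.
exact: (probability_le1 (normal_prob m s)).
Qed.

Lemma continuous_normal_cdf m s : s != 0 -> continuous (normal_cdf m s).
Proof.
move=> s0 x; apply/differentiable_continuous/derivable1_diffP.
by have [] := is_derive_normal_cdf m x s0.
Qed.

(** Both sides have the same derivative in [x], so their difference is constant; its limit at -oo
    shows that the constant is 0. *)
Lemma normal_cdf_std m s x : 0 < s ->
  normal_cdf m s x = normal_cdf 0 1 ((x - m) / s).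
Proof.
move=> s0; pose f y := normal_cdf m s y - normal_cdf 0 1 ((y - m) / s).
suff : f x = 0 by move/eqP; rewrite subr_eq0 => /eqP.
have s0' : s != 0 by rewrite gt_eqF.
have f0 y : is_derive y 1 f 0.
  have d1 := is_derive_normal_cdf m y s0'.
  have d2 := is_derive_normal_cdf 0 ((y - m) / s) (oner_neq0 R).
  have d3 : is_derive y 1 (fun y => (y - m) / s) s^-1.
    rewrite [X in is_derive _ _ X](_ : _ = (fun y => s^-1 *: (y - m))); last first.
      by apply/funext => z /=; rewrite mulrC.
    by apply: is_derive_eq; rewrite subr0 scaler1.
  have d4 := @is_derive1_comp _ (normal_cdf 0 1) (fun y => (y - m) / s) _ _ _ d2 d3.
  apply: is_derive_eq (is_deriveB d1 d4) _.
  rewrite !normal_pdfE ?oner_neq0// /normal_peak /normal_fun.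
  rewrite subr0.
  have -> : Num.sqrt (s ^+ 2 * pi *+ 2) = s * Num.sqrt (1 ^+ 2 * pi *+ 2).
    by rewrite -mulrnAr sqrtrM ?sqr_ge0// sqrtr_sqr gtr0_norm// expr1n mul1r.
  rewrite invfM.
  have -> : - (y - m) ^+ 2 / (s ^+ 2 *+ 2) = - ((y - m) / s) ^+ 2 / (1 ^+ 2 *+ 2).
    by field.
  by ring.
have fc y : f y = f x by exact: is_derive_0_is_cst.
have /cvg_lim <-// : f y @[y --> -oo] --> (0 : R); last first.
  rewrite (_ : f = cst (f x)) ?lim_cst//; first exact/funext.
rewrite -[X in _ --> X](subr0 0); apply: cvgB; first exact: cvg_normal_cdfNy.
apply: (@cvg_comp _ _ _ (fun y => (y - m) / s) (normal_cdf 0 1) _ -oo).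
  apply: gt0_cvgMlNy; first by rewrite invr_gt0.
  exact: cvg_addrr_Ny.
exact: cvg_normal_cdfNy.
Qed.

(** The density is even, so F(y) + F(-y) has zero derivative; its constant value is read off at
    +oo. *)
Lemma std_normal_cdfN x : normal_cdf 0 1 (- x) = 1 - normal_cdf 0 1 x.
Proof.
pose f y : R := normal_cdf 0 1 y + normal_cdf 0 1 (- y).
suff : f x = 1 by rewrite /f addrC => /(canRL (addrK _)).
have f0 y : is_derive y 1 f 0.
  have d1 := is_derive_normal_cdf 0 y (oner_neq0 R).
  have d2 := is_derive_normal_cdf 0 (- y) (oner_neq0 R).
  have d4 := @is_derive1_comp _ (normal_cdf 0 1) -%R _ _ _ d2 (is_deriveNid y 1).
  apply: is_derive_eq (is_deriveD d1 d4) _.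
  by rewrite !normal_pdfE ?oner_neq0// /normal_fun !subr0 sqrrN mulrN1 subrr.
have fc y : f y = f x by exact: is_derive_0_is_cst.
have /cvg_lim <-// : f y @[y --> +oo] --> (1 : R); last first.
  rewrite (_ : f = cst (f x)) ?lim_cst//; first exact/funext.
rewrite -[X in _ --> X](addr0 1); apply: cvgD; first exact: cvg_normal_cdfy.
apply: (@cvg_comp _ _ _ -%R (normal_cdf 0 1) _ -oo); last exact: cvg_normal_cdfNy.
exact/cvgNrNy.
Qed.

Lemma std_normal_invK (q : R) : 0 < q < 1 -> normal_cdf 0 1 (std_normal_inv q) = q.
Proof.
move=> /andP[q0 q1]; rewrite /std_normal_inv.
suff ex : exists z, normal_cdf 0 1 z = q by exact: getPex ex.
have [a aq] := filter_ex (cvgr_lt _ (cvg_normal_cdfNy 0 1) q q0).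
have [b bq] := filter_ex (cvgr_gt _ (cvg_normal_cdfy 0 1) q q1).
have ab : a <= b.
  rewrite leNgt; apply/negP => /(normal_cdf_lt 0 (oner_neq0 R)).
  by rewrite ltNge (ltW (lt_trans aq bq)).
have [||c _ <-] := @IVT R (normal_cdf 0 1) a b q ab.
- exact/continuous_subspaceT/continuous_normal_cdf/oner_neq0.
- by rewrite ge_min le_max (ltW aq) (ltW bq) orbT.
by exists c.
Qed.


End NormalCdf.

(** * Fixed points of bounded maps *)

Section FixedPoints.
Context {R : realType}.
Implicit Types (f g : R -> R) (lo hi x y z : R).

Lemma fixpoint_between g x y : continuous g ->
  x <= y -> x <= g x -> g y <= y -> exists2 z, x <= z <= y & z = g z.
Proof.
move=> gc xy xg gy.
have [||z] := @IVT R (fun z => z - g z) x y 0 xy.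
- by apply: continuous_subspaceT => z; apply: cvgB; [exact: cvg_id|exact: gc].
- by rewrite ge_min le_max subr_le0 xg (subr_ge0 (g y)) gy orbT.
rewrite in_itv/= => zxy /eqP; rewrite subr_eq0 => /eqP zg.
by exists z.
Qed.

Lemma bounded_fixpoint_exists g lo hi : continuous g ->
  (forall x, lo <= g x <= hi) -> exists z, z = g z.
Proof.
move=> gc gb.
have [|||z _ zg] := @fixpoint_between g lo hi gc.
- by have /andP[] := gb lo; exact: le_trans.
- by have /andP[] := gb lo.
- by have /andP[] := gb hi.
- by exists z.
Qed.

(** Otherwise the intermediate value theorem would give a second fixed point, at or below [x]. *)
Lemma unique_fixpoint_lt g lo hi z x : continuous g ->
  (forall y, lo <= g y <= hi) -> (forall y, y = g y -> y = z) ->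
  x < z -> x < g x.
Proof.
move=> gc gb guniq xz; rewrite ltNge; apply/negP => gx.
(* The left end is at most [lo], hence at most its own image. *)
have [|||y /andP[_ yx] /guniq yz] := @fixpoint_between g (Num.min x lo) x gc.
- by rewrite ge_min lexx.
- by rewrite ge_min; have /andP[-> _] := gb (Num.min x lo); rewrite orbT.
- by [].
by move: xz; rewrite -yz ltNge yx.
Qed.

Lemma unique_fixpoint_gt g lo hi z x : continuous g ->
  (forall y, lo <= g y <= hi) -> (forall y, y = g y -> y = z) ->
  z < x -> g x < x.
Proof.
move=> gc gb guniq xz; rewrite ltNge; apply/negP => gx.
have [|||y /andP[xy _] /guniq yz] := @fixpoint_between g x (Num.max x hi) gc.
- by rewrite le_max lexx.
- by [].
- by rewrite le_max; have /andP[_ ->] := gb (Num.max x hi); rewrite orbT.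
by move: xz; rewrite -yz ltNge xy.
Qed.

(** At [fp t - e] the map [g t] lies strictly above the diagonal and at [fp t + e] strictly below.
    Both inequalities persist for [u] near [t], and by uniqueness for [g u] they trap [fp u] between
    the two points. *)
Lemma unique_fixpoint_continuous (g : R -> R -> R) (fp : R -> R) lo hi t :
  (\forall u \near t, [/\ continuous (g u), forall x, lo <= g u x <= hi &
    forall x, x = g u x <-> x = fp u]) ->
  (forall x, {for t, continuous (fun u => g u x)}) ->
  {for t, continuous fp}.
Proof.
move=> gnear gc; have [gtc gtb gtu] := nbhs_singleton gnear.
have gt_uniq y : y = g t y -> y = fp t by move/gtu.
apply/cvgrPdist_lt => e e0; near=> u.
have [guc gub guu] : [/\ continuous (g u), forall x, lo <= g u x <= hi &
    forall x, x = g u x <-> x = fp u] by near: u.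
have gu_uniq y : y = g u y -> y = fp u by move/guu.
have lo_u : fp t - e < g u (fp t - e).
  near: u; apply: (cvgr_gt _ (gc _)).
  by apply: unique_fixpoint_lt gtc gtb gt_uniq _; rewrite ltrBlDr ltrDl.
have hi_u : g u (fp t + e) < fp t + e.
  near: u; apply: (cvgr_lt _ (gc _)).
  by apply: unique_fixpoint_gt gtc gtb gt_uniq _; rewrite ltrDl.
have fpu : fp u = g u (fp u) by apply/guu.
have h1 : fp t - e < fp u.
  rewrite ltNge; apply/negP; rewrite le_eqVlt => /predU1P[ue|].
    by move: lo_u; rewrite -ue -fpu ltxx.
  by move/(unique_fixpoint_gt guc gub gu_uniq); rewrite ltNge (ltW lo_u).
have h2 : fp u < fp t + e.
  rewrite ltNge; apply/negP; rewrite le_eqVlt => /predU1P[ue|].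
    by move: hi_u; rewrite ue -fpu ltxx.
  by move/(unique_fixpoint_lt guc gub gu_uniq); rewrite ltNge (ltW hi_u).
by rewrite distrC ltr_distl h1 h2.
Unshelve. all: by end_near. Qed.

(** Implicit differentiation in Carathéodory form: [F], [A] and [B] are replaced by their slope
    functions [q], [a] and [b], which turns the fixed-point equation into an exact linear equation
    for [fp u - fp t]. Continuity of [fp] at [t] then suffices to pass to the limit. *)
Lemma fixpoint_is_derive (F A B fp : R -> R) (c d t dF dA dB : R) :
  (\forall u \near t, fp u = c + d * F (A u * fp u + B u)) ->
  {for t, continuous fp} ->
  is_derive (A t * fp t + B t) 1 F dF ->
  is_derive t 1 A dA -> is_derive t 1 B dB ->
  1 - d * dF * A t != 0 ->
  is_derive t 1 fp (d * dF * (dA * fp t + dB) / (1 - d * dF * A t)).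
Proof.
move=> fpE fpc /is_derive1_caratheodory[q [qE qc qt]].
move=> /is_derive1_caratheodory[a [aE ac at_]].
move=> /is_derive1_caratheodory[b [bE bc bt]] D0.
have Ac : {for t, continuous A}.
  have -> : A = fun u => A t + a u * (u - t) by apply/funext => u; rewrite -aE; ring.
  apply: cvgD; first exact: cvg_cst.
  by apply: cvgM => //; apply: cvgB; [exact: cvg_id|exact: cvg_cst].
have Bc : {for t, continuous B}.
  have -> : B = fun u => B t + b u * (u - t) by apply/funext => u; rewrite -bE; ring.
  apply: cvgD; first exact: cvg_cst.
  by apply: cvgM => //; apply: cvgB; [exact: cvg_id|exact: cvg_cst].
pose Q u := q (A u * fp u + B u).
have Qt : Q t = dF by [].
have Qc : {for t, continuous Q}.
  apply: (@continuous_comp _ _ _ (fun u => A u * fp u + B u) q) => //.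
  by apply: cvgD => //; exact: cvgM.
(* The coefficient of [fp u - fp t] in the linear equation; it is nonzero at [t], hence near [t]. *)
pose N u := 1 - d * Q u * A u.
have Nc : {for t, continuous N}.
  apply: cvgB; first exact: cvg_cst.
  by apply: cvgM => //; apply: cvgM => //; exact: cvg_cst.
(* The slope function of [fp], obtained by solving the linear equation; its value at [t] is the
   claimed derivative. *)
pose G u := d * Q u * (a u * fp t + b u) / N u.
have Nt : N t != 0 by rewrite /N Qt.
have Gc : {for t, continuous G}.
  apply: cvgM; last exact: cvgV.
  apply: cvgM; first by apply: cvgM => //; exact: cvg_cst.
  by apply: cvgD => //; apply: cvgM => //; exact: cvg_cst.
apply: (@near_eq_is_derive _ _ _ (fun u => fp t + G u * (u - t))); last first.
  apply/is_derive1_caratheodory; exists G; split => //.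
    by move=> z; rewrite subrr mulr0; ring.
  by rewrite /G /N Qt at_ bt.
near=> u.
have Nu : N u != 0 by near: u; exact: (cvgr_neq0 _ Nc).
have fpu : fp u = c + d * F (A u * fp u + B u) by near: u.
have fpt : fp t = c + d * F (A t * fp t + B t) by exact: nbhs_singleton fpE.
have : (fp u - fp t) * N u = d * Q u * (a u * fp t + b u) * (u - t).
  have key : fp u - fp t = d * (Q u * (A u * fp u + B u - (A t * fp t + B t))).
    by rewrite /Q -qE {1}fpu {1}fpt; ring.
  (* The increment of [A u * fp u + B u] is split so that [fp u - fp t] appears with coefficient
     [A u]. *)
  have key2 : fp u - fp t =
      d * (Q u * (A u * (fp u - fp t) + a u * (u - t) * fp t + b u * (u - t))).
    by rewrite -aE -bE; apply: (etrans key); ring.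
  by rewrite /N mulrBr mulr1 {1}key2; ring.
move/(canRL (mulfK Nu)) => e.
have -> : G u * (u - t) = d * Q u * (a u * fp t + b u) * (u - t) / N u.
  by rewrite /G mulrAC.
by rewrite -e addrC subrK.
Unshelve. all: by end_near. Qed.

End FixedPoints.

(** * Fixed points of normal responses *)

Section NormalFixedPoint.
Context {R : realType}.
Implicit Types (c d k b x y z : R).

Local Notation Phi := (normal_cdf 0 1).
Local Notation phi := (normal_pdf 0 1).

Lemma normal_peak1 : normal_peak 1 = (Num.sqrt (2 * pi))^-1 :> R.
Proof. by rewrite /normal_peak expr1n mul1r mulr_natl. Qed.

Lemma std_normal_pdfE x : phi x = normal_peak 1 * expR (- (x ^+ 2 / 2)).
Proof. by rewrite normal_pdfE ?oner_neq0// /normal_fun subr0 expr1n mulNr. Qed.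

Lemma continuous_normal_response c d k b :
  continuous (fun x => c + d * Phi (k * x + b)).
Proof.
move=> x; apply: cvgD; first exact: cvg_cst.
apply: cvgM; first exact: cvg_cst.
apply: (@continuous_comp _ _ _ (fun x => k * x + b) Phi).
  by apply: cvgD; [apply: cvgM; [exact: cvg_cst|exact: cvg_id]|exact: cvg_cst].
exact/continuous_normal_cdf/oner_neq0.
Qed.

Lemma normal_response_bounded c d y : 0 < d -> c <= c + d * Phi y <= c + d.
Proof.
move=> d0; rewrite lerDl lerD2l ler_piMr ?(ltW d0)//; last first.
  by rewrite ltW// normal_cdf_lt1 ?oner_neq0.
by rewrite andbT mulr_ge0 ?ltW// normal_cdf_gt0 ?oner_neq0.
Qed.

Lemma is_derive_normal_response c d k b x :
  is_derive x 1 (fun x => x - (c + d * Phi (k * x + b)))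
    (1 - d * k * phi (k * x + b)).
Proof.
have d2 := is_derive_normal_cdf 0 (k * x + b) (oner_neq0 R).
have d3 : is_derive x 1 (fun x => k * x + b) k.
  rewrite [X in is_derive _ _ X](_ : _ = (fun y => k *: y + b))//.
  by apply: is_derive_eq; rewrite addr0 scaler1.
have d4 := @is_derive1_comp _ Phi (fun x => k * x + b) _ _ _ d2 d3.
rewrite [X in is_derive _ _ X](_ : _ =
  (fun y => y - (c + d *: (Phi \o (fun x => k * x + b)) y)))//.
apply: is_derive_eq.
by rewrite add0r /GRing.scale/=; ring.
Qed.

(** The normal density is at most [normal_peak 1], so x minus the response is strictly
    increasing. *)
Lemma small_slope_normal_fixpoint_unique c d k b y z : 0 < d -> 0 < k ->
  d * k * normal_peak 1 < 1 ->
  y = c + d * Phi (k * y + b) -> z = c + d * Phi (k * z + b) -> y = z.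
Proof.
move=> d0 k0 small.
have incr u v : u < v ->
    u - (c + d * Phi (k * u + b)) < v - (c + d * Phi (k * v + b)).
  move=> uv; rewrite -subr_gt0.
  have [w _ ->] := MVT_is_derive (is_derive_normal_response c d k b) uv.
  rewrite pmulr_lgt0 ?subr_gt0//; apply: le_lt_trans small.
  by rewrite ler_pM2l ?mulr_gt0// normal_pdf_ub// oner_neq0.
move=> yE zE; have [/incr|/incr|//] := ltgtP y z.
  by rewrite -yE -zE !subrr ltxx.
by rewrite -yE -zE !subrr ltxx.
Qed.

(** When the maximal slope exceeds 1, the slope of the response is above 1 exactly for |w| < [w1],
    where w = k x + b. Were it at least 1 at [z], then x - g x would decrease strictly from 0 while
    w crosses 0 to the opposite end of that interval, against the sign that uniqueness imposes. *)
Lemma unique_normal_fixpoint_slope c d k b z : 0 < d -> 0 < k ->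
  d * k * normal_peak 1 != 1 ->
  z = c + d * Phi (k * z + b) ->
  (forall y, y = c + d * Phi (k * y + b) -> y = z) ->
  d * k * phi (k * z + b) < 1.
Proof.
move=> d0 k0 crit zE uniq.
have dk0 : 0 < d * k by rewrite mulr_gt0.
have [small|large] := ltP (d * k * normal_peak 1) 1.
  by apply: le_lt_trans small; rewrite ler_pM2l// normal_pdf_ub// oner_neq0.
have {crit large} large : 1 < d * k * normal_peak 1 by rewrite lt_neqAle eq_sym crit.
rewrite ltNge; apply/negP => slope.
pose g x := c + d * Phi (k * x + b).
have gc : continuous g by exact: continuous_normal_response.
have gb x : c <= g x <= c + d by exact: normal_response_bounded.
(* The slope at w is exp(L - w^2/2), so comparing it with 1 amounts to comparing w^2 with 2 L. *)
pose L := ln (d * k * normal_peak 1).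
have L0 : 0 < L by rewrite ln_gt0.
have pdf_gt w : w ^+ 2 < 2 * L -> 1 < d * k * phi w.
  move=> wL; rewrite std_normal_pdfE mulrA -[X in X * _]lnK ?posrE;
    last exact: lt_trans large.
  by rewrite -expRD -[ltLHS]expR0 ltr_expR -/L; lra.
have pdf_ge w : 1 <= d * k * phi w -> w ^+ 2 <= 2 * L.
  rewrite std_normal_pdfE mulrA -[X in _ <= X * _]lnK ?posrE;
    last exact: lt_trans large.
  by rewrite -expRD -[leLHS]expR0 ler_expR -/L; lra.
pose w1 := Num.sqrt (2 * L).
have w10 : 0 < w1 by rewrite sqrtr_gt0; lra.
have w1E : w1 ^+ 2 = 2 * L by rewrite sqr_sqrtr//; lra.
pose w0 := k * z + b.
have {pdf_ge slope} w0E : w0 ^+ 2 <= w1 ^+ 2 by rewrite w1E; exact: pdf_ge.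
have w01 : - w1 <= w0 <= w1 by apply/andP; split; nra.
have ginv w : k * ((w - b) / k) + b = w by field; rewrite gt_eqF.
have decr x y : x < y -> - w1 <= k * x + b -> k * y + b <= w1 ->
    y - g y < x - g x.
  move=> xy wx wy; rewrite -subr_lt0.
  have [w] := MVT_is_derive (is_derive_normal_response c d k b) xy.
  rewrite in_itv/= => /andP[xw wy' ->].
  rewrite nmulr_rlt0 ?subr_gt0// subr_lt0; apply: pdf_gt; rewrite -w1E.
  have : k * x < k * w by rewrite ltr_pM2l.
  have : k * w < k * y by rewrite ltr_pM2l.
  by move=> ? ?; nra.
have hz : z - g z = 0 by rewrite /g -zE subrr.
(* Moving towards and past 0 keeps the interval nondegenerate even when [w0] is an endpoint, where
   the slope is exactly 1. *)
have [w0_le|w0_gt] := leP w0 0.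
  pose y := (w1 - b) / k.
  have zy : z < y by rewrite ltr_pdivlMr//; move: w0_le; rewrite /w0; lra.
  have /andP[w0l _] := w01.
  have := decr _ _ zy w0l; rewrite ginv => /(_ (lexx _)).
  by rewrite hz subr_lt0 ltNge (ltW (unique_fixpoint_gt gc gb uniq zy)).
pose y := (- w1 - b) / k.
have yz : y < z by rewrite ltr_pdivrMr//; move: w0_gt; rewrite /w0; lra.
have /andP[_ w0r] := w01.
have := decr _ _ yz; rewrite ginv => /(_ (lexx _) w0r).
by rewrite hz subr_gt0 ltNge (ltW (unique_fixpoint_lt gc gb uniq yz)).
Qed.

End NormalFixedPoint.

(** * Reduction of the equilibrium to a fixed point *)

Section Equilibrium.
Context {R : realType}.
Variables (a : bool) (mu sigma delta eta : R).
Hypotheses (sigma_gt0 : 0 < sigma) (delta_lt1 : delta < 1) (eta_gt0 : 0 < eta).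

Local Notation Phi := (normal_cdf 0 1).
Local Notation tau := (sigma ^- 2).
Local Notation k := (std_normal_inv (1 / (1 + eta))).

(* In the notation of the header, w = theta_coef u * theta + theta_shift u. *)
Definition theta_coef (u : R) : R := tau / Num.sqrt u.

Definition theta_shift (u : R) : R :=
  (k * Num.sqrt (tau + u) - tau * mu) / Num.sqrt u.

(** The mass sold at [theta] when investors switch at the signal that makes them indifferent given
    critical fundamental [theta]. *)
Definition reduced_mass (u theta : R) : R :=
  a%:R * delta + (1 - delta) * Phi (theta_coef u * theta + theta_shift u).

Definition threshold_at (u theta : R) : R :=
  ((tau + u) * theta + k * Num.sqrt (tau + u) - tau * mu) / u.

Let tau_gt0 : 0 < tau. Proof. by rewrite invr_gt0 exprn_gt0. Qed.

Let std_normal_kK : Phi k = 1 / (1 + eta).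
Proof.
apply: std_normal_invK; rewrite divr_gt0 ?addr_gt0//= ltr_pdivrMr ?addr_gt0//.
by rewrite mul1r ltrDl.
Qed.

(** If k <= 0, then F(k) <= F(-k) = 1 - F(k), so 1/(1 + eta) <= 1/2 and eta >= 1. *)
Lemma std_normal_inv_gt0 : eta < 1 -> 0 < k.
Proof.
move=> eta1; rewrite ltNge; apply/negP => k0.
have : Phi k <= Phi (- k).
  have [->|kN0] := eqVneq k 0; first by rewrite oppr0.
  by apply/ltW/(normal_cdf_lt 0 (oner_neq0 R)); rewrite (@lt_trans _ _ 0)// ?oppr_gt0
    lt_neqAle kN0.
rewrite std_normal_cdfN std_normal_kK; rewrite -subr_ge0.
have -> : 1 - 1 / (1 + eta) - 1 / (1 + eta) = (eta - 1) / (1 + eta).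
  by field; rewrite gt_eqF// addr_gt0.
by rewrite pmulr_lge0 ?invr_gt0 ?addr_gt0// subr_ge0 leNgt eta1.
Qed.

Lemma mass_sold_std (u x theta : R) : 0 < u ->
  mass_sold a delta (sd_of_precision u) x theta =
  a%:R * delta + (1 - delta) * Phi (- Num.sqrt u * theta + Num.sqrt u * x).
Proof.
move=> u0; rewrite /mass_sold normal_cdf_std ?invr_gt0 ?sqrtr_gt0//.
by rewrite -std_normal_cdfN /sd_of_precision invrK; congr (_ + _ * Phi _); ring.
Qed.

(** The mass sold is continuous, bounded and strictly decreasing in [theta], so it has exactly one
    fixed point, and [get] returns it. *)
Lemma theta_barE (u x theta : R) : 0 < u ->
  theta = mass_sold a delta (sd_of_precision u) x theta <->
  theta = theta_bar a delta (sd_of_precision u) x.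
Proof.
move=> u0.
have d0 : 0 < 1 - delta by rewrite subr_gt0.
have uniq y z : y = mass_sold a delta (sd_of_precision u) x y ->
    z = mass_sold a delta (sd_of_precision u) x z -> y < z -> False.
  rewrite !mass_sold_std// => yE zE yz; move: (yz);
    rewrite yE zE ltNge => /negP; apply.
  rewrite lerD2l ler_pM2l//; apply/ltW/(normal_cdf_lt 0 (oner_neq0 R)).
  by rewrite ltrD2r ltr_nM2l// oppr_lt0 sqrtr_gt0.
have ex : exists y, y = mass_sold a delta (sd_of_precision u) x y.
  have [||y yE] := @bounded_fixpoint_exists _
     (mass_sold a delta (sd_of_precision u) x) (a%:R * delta) (a%:R * delta + (1 - delta)).
  - have -> : mass_sold a delta (sd_of_precision u) x = (fun y =>
        a%:R * delta + (1 - delta) * Phi (- Num.sqrt u * y + Num.sqrt u * x)).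
      by apply/funext => y; exact: mass_sold_std.
    exact: continuous_normal_response.
  - by move=> y; rewrite mass_sold_std//; exact: normal_response_bounded.
  - by exists y.
have P : theta_bar a delta (sd_of_precision u) x =
    mass_sold a delta (sd_of_precision u) x (theta_bar a delta (sd_of_precision u) x).
  exact: (getPex ex).
split => [thetaE|->//].
have [/uniq|/uniq|//] := ltgtP theta (theta_bar a delta (sd_of_precision u) x).
  by case.
by case.
Qed.

(** The posterior has precision tau + u, and indifference says that the posterior probability G is
    eta/(1 + eta) = F(-k). Injectivity of F makes this an equation between arguments, which is
    solved for [x]. *)
Lemma indifferentE (u x : R) : 0 < u ->
  indifferent a mu sigma delta eta (sd_of_precision u) x <->
  x = threshold_at u (theta_bar a delta (sd_of_precision u) x).
Proof.
move=> u0; rewrite /indifferent; set theta := theta_bar _ _ _ _.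
have tu0 : 0 < tau + u by rewrite addr_gt0.
have s0 : sigma != 0 by rewrite gt_eqF.
have u0' : u != 0 by rewrite gt_eqF.
have sdE : sd_of_precision u ^+ 2 = u^-1.
  by rewrite /sd_of_precision exprVn sqr_sqrtr// ltW.
have tuE : tau + u = (1 + u * sigma ^+ 2) / sigma ^+ 2 by field; rewrite s0.
have us0 : 1 + u * sigma ^+ 2 != 0.
  by rewrite gt_eqF// addr_gt0// mulr_gt0// exprn_gt0.
have psd : post_sd sigma (sd_of_precision u) = (Num.sqrt (tau + u))^-1.
  rewrite /post_sd sdE -sqrtrV ?ltW//; congr Num.sqrt.
  by rewrite tuE; field; rewrite us0 s0 u0'.
have pm : post_mean mu sigma (sd_of_precision u) x = (u * x + tau * mu) / (tau + u).
  by rewrite /post_mean sdE tuE; field; rewrite us0 s0 u0'.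
have sq0 : 0 < Num.sqrt (tau + u) by rewrite sqrtr_gt0.
have post_cdfE : normal_cdf (post_mean mu sigma (sd_of_precision u) x)
    (post_sd sigma (sd_of_precision u)) theta =
    Phi ((theta - (u * x + tau * mu) / (tau + u)) * Num.sqrt (tau + u)).
  by rewrite normal_cdf_std psd ?invr_gt0// pm invrK.
rewrite /= post_cdfE.
set y := (theta - _) * _.
have e0 : 1 + eta != 0 by rewrite gt_eqF// addr_gt0.
have sqE : Num.sqrt (tau + u) ^+ 2 = tau + u by rewrite sqr_sqrtr// ltW.
have thE : x = threshold_at u theta <-> y = - k.
  rewrite /threshold_at /y; set q := Num.sqrt (tau + u).
  have q0 : q != 0 by rewrite gt_eqF.
  rewrite -[tau + u]sqE -/q; split => [xE|yE].
    have -> : u * x + tau * mu = q ^+ 2 * theta + k * q.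
      by rewrite xE mulrCA divff// mulr1; ring.
    by field.
  have -> : k = - ((theta - (u * x + tau * mu) / q ^+ 2) * q) by rewrite yE opprK.
  by move: (tau) => t; field; rewrite u0' q0.
have PhiE : Phi y - eta * (1 - Phi y) = 0 <-> Phi y = Phi (- k).
  rewrite std_normal_cdfN std_normal_kK; split => [/eqP|->]; last by field.
  move=> /eqP e; apply: (@mulfI _ (1 + eta)) => //.
  have -> : (1 + eta) * (1 - 1 / (1 + eta)) = eta by field.
  by apply/eqP; rewrite -subr_eq0 -[X in _ == X]e; apply/eqP; ring.
rewrite PhiE thE; split => [|->//] yk.
have [/(normal_cdf_lt 0 (oner_neq0 R))|/(normal_cdf_lt 0 (oner_neq0 R))|//] :=
  ltgtP y (- k).
  by rewrite yk ltxx.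
by rewrite yk ltxx.
Qed.

Lemma mass_sold_threshold_at (u theta : R) : 0 < u ->
  mass_sold a delta (sd_of_precision u) (threshold_at u theta) theta =
  reduced_mass u theta.
Proof.
move=> u0; rewrite mass_sold_std// /reduced_mass; congr (_ + _ * Phi _).
rewrite /threshold_at /theta_coef /theta_shift.
have -> : u = Num.sqrt u ^+ 2 by rewrite sqr_sqrtr// ltW.
rewrite sqrtr_sqr ger0_norm ?sqrtr_ge0//.
have q0 : Num.sqrt u != 0 by rewrite gt_eqF// sqrtr_gt0.
move: (tau) (Num.sqrt u) q0 => t q q0; move: (Num.sqrt _) => r.
by field.
Qed.

(** Every fixed point yields an equilibrium threshold from which [theta_bar] recovers it. This gives
    existence of thresholds and carries their uniqueness over to fixed points. *)
Lemma threshold_at_indifferent (u theta : R) : 0 < u ->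
  theta = reduced_mass u theta ->
  theta_bar a delta (sd_of_precision u) (threshold_at u theta) = theta /\
  indifferent a mu sigma delta eta (sd_of_precision u) (threshold_at u theta).
Proof.
move=> u0 thetaE; have e :
    theta_bar a delta (sd_of_precision u) (threshold_at u theta) = theta.
  by apply/esym/theta_barE => //; rewrite mass_sold_threshold_at.
by split => //; apply/indifferentE => //; rewrite e.
Qed.

Lemma continuous_reduced_mass u : continuous (reduced_mass u).
Proof. exact: continuous_normal_response. Qed.

Lemma reduced_mass_bounded u theta :
  a%:R * delta <= reduced_mass u theta <= a%:R * delta + (1 - delta).
Proof. by apply: normal_response_bounded; rewrite subr_gt0. Qed.

Lemma unique_theta_star (u : R) : 0 < u ->
  (forall y z, y = reduced_mass u y -> z = reduced_mass u z -> y = z) ->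
  forall theta, theta = reduced_mass u theta <->
    theta = theta_star a mu sigma delta eta (sd_of_precision u).
Proof.
move=> u0 uniq.
have [y yE] := bounded_fixpoint_exists (@continuous_reduced_mass u) (reduced_mass_bounded u).
have ex : exists x, indifferent a mu sigma delta eta (sd_of_precision u) x.
  by exists (threshold_at u y); have [] := threshold_at_indifferent u0 yE.
(* An indifferent signal exists, so [get] returns a genuine one and not its default value. *)
have xstarP : indifferent a mu sigma delta eta (sd_of_precision u)
    (x_star a mu sigma delta eta (sd_of_precision u)) by exact: (getPex ex).
have starE : theta_star a mu sigma delta eta (sd_of_precision u) =
    reduced_mass u (theta_star a mu sigma delta eta (sd_of_precision u)).
  rewrite -mass_sold_threshold_at//; have /= <- := (indifferentE _ u0).1 xstarP.
  exact/theta_barE.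
by move=> theta; split => [/uniq|->//]; exact.
Qed.

Lemma unique_threshold (u : R) : 0 < u ->
  (exists! x, indifferent a mu sigma delta eta (sd_of_precision u) x) ->
  forall y z, y = reduced_mass u y -> z = reduced_mass u z -> y = z.
Proof.
move=> u0 [x [_ xuniq]] y z.
move=> /(threshold_at_indifferent u0)[ey /xuniq xy].
move=> /(threshold_at_indifferent u0)[ez /xuniq xz].
by rewrite -ey -ez -xy -xz.
Qed.

End Equilibrium.

(** * Dependence on the precision *)

Section ComparativeStatics.
Context {R : realType}.
Variables (a : bool) (mu sigma delta eta : R).
Hypotheses (sigma_gt0 : 0 < sigma) (delta_lt1 : delta < 1) (eta_gt0 : 0 < eta).

Local Notation Phi := (normal_cdf 0 1).
Local Notation phi := (normal_pdf 0 1).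
Local Notation tau := (sigma ^- 2).
Local Notation k := (std_normal_inv (1 / (1 + eta))).
Local Notation coef := (theta_coef sigma).
Local Notation shift := (theta_shift mu sigma eta).
Local Notation theta u := (theta_star a mu sigma delta eta (sd_of_precision u)).

Let tau_gt0 : 0 < tau. Proof. by rewrite invr_gt0 exprn_gt0. Qed.

Lemma is_derive_theta_coef (t : R) : 0 < t ->
  is_derive t 1 coef (- (tau / (2 * Num.sqrt t ^+ 3))).
Proof.
move=> t0; have q0 : Num.sqrt t != 0 by rewrite gt_eqF// sqrtr_gt0.
have dq := is_derive1_sqrt t0.
have -> : coef = tau *: (fun u => (Num.sqrt u)^-1) by [].
have dV := @is_deriveV _ _ _ _ _ q0 dq.
apply: is_derive_eq (is_deriveZ tau dV) _.
rewrite /GRing.scale/=; move: tau => s; field.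
exact: q0.
Qed.

Lemma is_derive_theta_shift (t : R) : 0 < t ->
  is_derive t 1 shift
    (tau * (mu - k / Num.sqrt (tau + t)) / (2 * Num.sqrt t ^+ 3)).
Proof.
move=> t0; have q0 : Num.sqrt t != 0 by rewrite gt_eqF// sqrtr_gt0.
have tt0 : 0 < tau + t by rewrite addr_gt0.
have r0 : Num.sqrt (tau + t) != 0 by rewrite gt_eqF// sqrtr_gt0.
have dq := is_derive1_sqrt t0.
have dV := @is_deriveV _ _ _ _ _ q0 dq.
have dr := is_derive1_sqrt tt0.
have dr' : is_derive t 1 (fun u => tau + u) 1.
  exact: is_derive_eq (is_deriveD (is_derive_cst tau t 1) (is_derive_id t 1)) (add0r _).
have dN := is_deriveB (is_deriveZ k (@is_derive1_comp _ (@Num.sqrt R) _ _ _ _ dr dr'))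
  (is_derive_cst (tau * mu) t 1).
apply: is_derive_eq (is_deriveM dN dV) _.
rewrite /GRing.scale/=.
set q := Num.sqrt t in q0 *; set r := Num.sqrt (tau + t) in r0 *.
(* Writing tau through the two square roots lets the k-terms of the quotient rule combine. *)
have tauE : tau = r ^+ 2 - q ^+ 2.
  by rewrite (sqr_sqrtr (ltW tt0)) (sqr_sqrtr (ltW t0)) addrK.
have -> : (k \*: (Num.sqrt \o +%R tau) - cst (tau * mu)) t = k * r - tau * mu by [].
rewrite tauE; field.
by rewrite q0 r0.
Qed.

Let deriv_cont (f : R -> R) (x df : R) : is_derive x 1 f df -> {for x, continuous f}.
Proof. by move=> [fx _]; apply/differentiable_continuous/derivable1_diffP. Qed.

(** Isolating a positive factor [c] leaves a term whose sign is the one that the two cases of the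
    theorem control. *)
Lemma theta_star_is_derive (t : R) : 0 < t ->
  (1 - delta) * coef t * normal_peak 1 != 1 ->
  (\forall u \near t, forall y z, y = reduced_mass a mu sigma delta eta u y ->
    z = reduced_mass a mu sigma delta eta u z -> y = z) ->
  exists2 c, 0 < c & is_derive t 1 (fun u => theta u)
    (c * (mu - (theta t + k / Num.sqrt (tau + t)))).
Proof.
move=> t0 crit uniq.
have d0 : 0 < 1 - delta by rewrite subr_gt0.
have q0 : 0 < Num.sqrt t by rewrite sqrtr_gt0.
have fpE : \forall u \near t, forall x,
    x = reduced_mass a mu sigma delta eta u x <-> x = theta u.
  near=> u; apply: unique_theta_star => //; near: u => //.
  exact: lt_nbhsr.
have fptE := nbhs_singleton fpE.
have coef0 : 0 < coef t by rewrite divr_gt0.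
have dA := is_derive_theta_coef t0.
have dB := is_derive_theta_shift t0.
have thc : {for t, continuous (fun u => theta u)}.
  apply: (@unique_fixpoint_continuous _ (reduced_mass a mu sigma delta eta) _
    (a%:R * delta) (a%:R * delta + (1 - delta))).
    near=> u; split; [exact: continuous_reduced_mass|
      by move=> x; exact: reduced_mass_bounded|by near: u].
  move=> x; apply: cvgD; first exact: cvg_cst.
  apply: cvgM; first exact: cvg_cst.
  apply: (@continuous_comp _ _ _ (fun u => coef u * x + shift u) Phi).
    apply: cvgD; last exact: deriv_cont dB.
    by apply: cvgM; [exact: deriv_cont dA|exact: cvg_cst].
  exact/continuous_normal_cdf/oner_neq0.
have slope : (1 - delta) * coef t * phi (coef t * theta t + shift t) < 1.
  apply: (unique_normal_fixpoint_slope (c := a%:R * delta)) => //.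
    exact/fptE.
  by move=> y /fptE.
set F := phi _ in slope.
have F0 : 0 < F by rewrite normal_pdf_gt0// oner_neq0.
have D0 : 0 < 1 - (1 - delta) * F * coef t by rewrite subr_gt0 mulrAC.
(* The derivatives of [coef] and [shift] share the factor tau / (2 t^(3/2)); the denominator is the
   D of implicit differentiation. *)
exists ((1 - delta) * F * (tau / (2 * Num.sqrt t ^+ 3)) /
  (1 - (1 - delta) * F * coef t)).
  by rewrite !(divr_gt0, mulr_gt0, exprn_gt0).
have dtheta := @fixpoint_is_derive _ Phi coef shift (fun u => theta u)
  (a%:R * delta) (1 - delta) t F _ _ _ thc
  (is_derive_normal_cdf 0 _ (oner_neq0 R)) dA dB (lt0r_neq0 D0).
apply: is_derive_eq (dtheta _) _.
  by near=> u; apply/(near fpE u).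
set D := 1 - _ in D0 *; move: (tau) (Num.sqrt (tau + t)) => s r.
by ring.
Unshelve. all: by end_near. Qed.

End ComparativeStatics.

(** * The signs of the derivatives of the risk components *)

Theorem proposition3p3 (R : realType) (mu sigma sigma_x delta p eta : R)
    (a : bool)
    (sigma_gt0 : 0 < sigma) (sigma_x_gt0 : 0 < sigma_x)
    (delta01 : 0 < delta < 1) (p01 : 0 <= p <= 1)
    (eta_gt0 : 0 < eta) (eta_lt1 : eta < 1)
    (small_noise : (1 - delta) * sigma_x < Num.sqrt (2 * pi) * sigma ^+ 3)
    (state_a_possible : 0 < state_prob p a)
    (regular : 1 < sigma -> regular_equilibrium a mu sigma delta eta (sigma_x ^- 2)) :
  let tau := sigma ^- 2 in
  let tau_x := sigma_x ^- 2 in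
  let theta := theta_star a mu sigma delta eta sigma_x in
  let Ra := risk_of_precision a mu sigma delta eta p in
  (mu > theta + std_normal_inv (1 / (1 + eta)) / Num.sqrt (tau + tau_x) ->
     derivable Ra tau_x 1 /\ 0 < derive1 Ra tau_x) /\
  (mu < theta ->
     derivable Ra tau_x 1 /\ derive1 Ra tau_x < 0).
Proof.
have /andP[delta_gt0 delta_lt1] := delta01.
move=> tau tau_x theta Ra.
have d0 : 0 < 1 - delta by rewrite subr_gt0.
have tx0 : 0 < tau_x by rewrite invr_gt0 exprn_gt0.
have sqrt_tx : Num.sqrt tau_x = sigma_x^-1.
  by rewrite /tau_x -exprVn sqrtr_sqr gtr0_norm// invr_gt0.
have sd_tx : sd_of_precision tau_x = sigma_x by rewrite /sd_of_precision sqrt_tx invrK.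
have pi20 : 0 < Num.sqrt (2 * pi) :> R by rewrite sqrtr_gt0 mulr_gt0// pi_gt0.
have slopeE u : (1 - delta) * theta_coef sigma u * normal_peak 1 =
    (1 - delta) * sd_of_precision u / (Num.sqrt (2 * pi) * sigma ^+ 2).
  by rewrite /theta_coef /sd_of_precision normal_peak1 [in RHS]invfM; ring.
have critE u : ((1 - delta) * theta_coef sigma u * normal_peak 1 < 1) =
    ((1 - delta) * sd_of_precision u < Num.sqrt (2 * pi) * sigma ^+ 2).
  by rewrite slopeE ltr_pdivrMr ?mul1r// mulr_gt0// exprn_gt0.
have [crit uniq] : (1 - delta) * theta_coef sigma tau_x * normal_peak 1 != 1 /\
   (\forall u \near tau_x, forall y z, y = reduced_mass a mu sigma delta eta u y ->
    z = reduced_mass a mu sigma delta eta u z -> y = z).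
  (* If sigma <= 1, then sigma^3 <= sigma^2 and [small_noise] already bounds the maximal slope below
     1. If sigma > 1, [regular] supplies both claims. *)
  have [sigma_le1|/regular[crit ex]] := leP sigma 1.
    have crit : (1 - delta) * theta_coef sigma tau_x * normal_peak 1 < 1.
      rewrite critE sd_tx (lt_le_trans small_noise)// ler_pM2l//.
      by rewrite exprS ler_piMl// exprn_ge0// ltW.
    split; first by rewrite lt_eqF.
    near=> u => y z; apply: small_slope_normal_fixpoint_unique => //.
      by rewrite divr_gt0 ?invr_gt0 ?exprn_gt0// sqrtr_gt0; near: u; exact: lt_nbhsr.
    (* The slope bound is strict and continuous in the precision, so it persists near [tau_x]. *)
    near: u; apply: (cvgr_lt _ _ _ crit).
    apply: cvgM; last exact: cvg_cst.
    apply: cvgM; first exact: cvg_cst.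
    have [dcoef _] := is_derive_theta_coef sigma tx0.
    exact/differentiable_continuous/derivable1_diffP.
  split.
    rewrite slopeE; apply/eqP => /(canRL (divfK _)) e; apply: crit; rewrite e ?mul1r//.
    by rewrite gt_eqF// mulr_gt0// exprn_gt0.
  near=> u; apply: unique_threshold => //; near: u => //.
  exact: lt_nbhsr.
have [c c0] := theta_star_is_derive sigma_gt0 delta_lt1 eta_gt0 tx0 crit uniq.
rewrite sd_tx -/theta -/tau => dtheta.
have sN0 : sigma != 0 by rewrite gt_eqF.
have dF := is_derive_normal_cdf mu
  (theta_star a mu sigma delta eta (sd_of_precision tau_x)) sN0.
have dR := is_deriveZ (state_prob p a) (@is_derive1_comp _ (normal_cdf mu sigma)
  (fun u => theta_star a mu sigma delta eta (sd_of_precision u)) _ _ _ dF dtheta).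
have {dF} [dRa Ra'] : is_derive tau_x 1 Ra _ := dR.
have K0 : 0 < state_prob p a * normal_pdf mu sigma theta * c.
  by rewrite !mulr_gt0// normal_pdf_gt0.
have {}Ra' : derive1 Ra tau_x = state_prob p a * normal_pdf mu sigma theta * c *
    (mu - (theta + std_normal_inv (1 / (1 + eta)) / Num.sqrt (tau + tau_x))).
  by rewrite derive1E Ra' sd_tx /GRing.scale/= !mulrA.
(* Since this term is positive, [mu < theta] already makes the signed factor negative. *)
have k0 : 0 < std_normal_inv (1 / (1 + eta)) / Num.sqrt (tau + tau_x).
  by rewrite divr_gt0 ?std_normal_inv_gt0// sqrtr_gt0 addr_gt0// invr_gt0 exprn_gt0.
split=> mu_theta; split => //; rewrite Ra'.
  by rewrite mulr_gt0// subr_gt0.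
by rewrite pmulr_rlt0// subr_lt0 (lt_trans mu_theta)// ltrDl.
Unshelve. all: by end_near. Qed.
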